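(* Let $k\ge 1$, let $P$ be an oriented path of length $n\ge 1$ (i.e.\ with $n$ edges), and let $l=l(P)$. Then, with $c_k=8^k\cdot k!$, $$n\cdot l^{k-1}\le \mathrm{RT}(P,k)\le c_k\cdot n\cdot l^{k-1}.$$
   Context: An oriented path is a path whose edges may be oriented arbitrarily, with no bidirected edges. The length of a path is its number of edges. For an oriented path $P$, $l(P)$ denotes the length of the longest directed subpath of $P$ (a subpath all of whose edges are oriented in the same direction along the path). A tournament is an oriented graph with exactly one edge between every pair of distinct vertices. A $k$-colouring is an edge-colouring with colours $\{1,\dots,k\}$. The $k$-colour oriented Ramsey number $\mathrm{RT}(H,k)$ is the least integer $N$ such that every $k$-coloured tournament on $N$ vertices contains a monochromatic copy (not necessarily induced subgraph isomorphic as a directed graph) of $H$. *)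

(* Defs.v *)
From mathcomp Require Import all_boot.
Set Implicit Arguments. Unset Strict Implicit. Unset Printing Implicit Defensive.

Definition tournament (N : nat) (T : rel 'I_N) : Prop :=
  (forall i, ~~ T i i) /\
  (forall i j, i != j -> (T i j || T j i) && ~~ (T i j && T j i)).

(* An oriented path of length n: vertices 0..n (type 'I_n.+1), and edge e
   (between e and e+1) is oriented e -> e+1 if o e = true, e+1 -> e otherwise. *)
Definition pvert n (e : 'I_n) : 'I_n.+1 := widen_ord (leqnSn n) e.
Definition pvert' n (e : 'I_n) : 'I_n.+1 := lift ord0 e.

Definition directed_run n (o : 'I_n -> bool) (i j : nat) : bool :=
  [forall e1 : 'I_n, forall e2 : 'I_n,
     ((i <= e1 < j) && (i <= e2 < j)) ==> (o e1 == o e2)].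

Definition lP n (o : 'I_n -> bool) : nat :=
  \max_(i < n.+1) \max_(j < n.+1 | (i <= j) && directed_run o i j) (j - i).

Definition mono_copy n (o : 'I_n -> bool) N (T : rel 'I_N) k
    (c : 'I_N -> 'I_N -> 'I_k) (col : 'I_k) : Prop :=
  exists f : 'I_n.+1 -> 'I_N, injective f /\
    forall e : 'I_n,
      let u := f (pvert e) in let v := f (pvert' e) in
      if o e then T u v /\ c u v = col else T v u /\ c v u = col.

Definition ramsey_prop n (o : 'I_n -> bool) k N : Prop :=
  forall (T : rel 'I_N) (c : 'I_N -> 'I_N -> 'I_k),
    tournament T -> exists col : 'I_k, mono_copy o T c col.

Definition is_RT n (o : 'I_n -> bool) k N0 : Prop :=
  ramsey_prop o k N0 /\ forall N, ramsey_prop o k N -> N0 <= N.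

Definition c_const (k : nat) : nat := 8 ^ k * k`!.

(* Main.v *)
Require Import Defs.
From mathcomp Require Import all_boot.
From mathcomp Require Import zify.
From Stdlib Require Import Classical.
Set Implicit Arguments. Unset Strict Implicit. Unset Printing Implicit Defensive.

(* Lower bound: order N <= n * l^(k-1) points naturally and colour the pair
   x, y by the least j such that x / n and y / n agree after division by l^j.
   Colour 0 lives inside blocks of size n, and in a colour j > 0 the quotient by
   l^(j-1) strictly increases along arcs but keeps its quotient by l, so that no
   directed path has l arcs.

   Upper bound, by induction on k: let |S| >= 8kd with d = c_(k-1) n l^(k-1).
   Some colour is dense enough to contain nonempty sets A, B such that every
   vertex of A has d out-neighbours in B and every vertex of B has d
   in-neighbours in A.  If every set without arcs of that colour is smaller than
   d / l, then by the Gallai-Roy theorem the unused part of each of these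
   neighbourhoods contains directed paths long enough to embed the path one
   directed run at a time, forward runs going from A to B and backward runs from
   B to A.  Otherwise a set of size d / l misses the colour, and induction
   applies to it; for k = 1 the sets without arcs are the singletons. *)

(** * Long directed paths in the absence of large stable sets *)

Section GallaiRoy.
Variable V : finType.
Implicit Types (F : {set V * V}) (e : rel V) (S W : {set V}).

Definition arc_rel F : rel V := fun x y => (x, y) \in F.

Definition acyclic F := [forall p in F, ~~ connect (arc_rel F) p.2 p.1].

Lemma acyclicP F :
  reflect (forall x y, (x, y) \in F -> ~~ connect (arc_rel F) y x) (acyclic F).
Proof.
by apply: (iffP forall_inP) => [H x y /H | H [x y] /H].
Qed.

(** Cut a walk before its first and after its last use of the new arc. *)
Lemma connect_setU1 F u v a b :
    connect (arc_rel ((u, v) |: F)) a b ->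
  connect (arc_rel F) a b \/
  connect (arc_rel F) a u /\ connect (arc_rel F) v b.
Proof.
case/connectP=> p; elim: p a => [|c p IHp] a /=; first by move=> _ ->; left.
case/andP=> ac cp bE; have [cb | [cu vb]] := IHp c cp bE.
- move: ac; rewrite /arc_rel in_setU1 => /predU1P[[-> <-] | ac].
    by right; split.
  by left; apply: connect_trans cb; apply: connect1.
- right; split=> //; move: ac; rewrite /arc_rel in_setU1 => /predU1P[[-> _] // | ac].
  by apply: connect_trans cu; apply: connect1.
Qed.

(** Take [F] maximal under inclusion: an arc that cannot be added closes a cycle, so its head
    already reaches its tail in [F]. *)
Lemma max_acyclic (E : {set V * V}) :
  exists F, [/\ F \subset E, acyclic F &
    forall u v, (u, v) \in E -> (u, v) \in F \/ connect (arc_rel F) v u].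
Proof.
have P0 : (fun F => acyclic F && (F \subset E)) set0.
  by rewrite sub0set andbT; apply/acyclicP => x y; rewrite inE.
have [F /maxsetP[/andP[acF FE] maxF] _] :=
  maxset_exists (P := fun F => acyclic F && (F \subset E)) P0.
exists F; split=> // u v uvE.
have [vu | Nvu] := boolP (connect (arc_rel F) v u); first by right.
left; rewrite -(maxF ((u, v) |: F)) ?setU11 ?subsetUr //.
rewrite subUset sub1set uvE FE !andbT; apply/acyclicP => x y.
rewrite in_setU1 => xy; apply/negP => /connect_setU1.
case/orP: xy => [/eqP[-> ->] | xyF].
  by case=> [|[]] vu; rewrite vu in Nvu.
case=> [|[yu vx]]; first by apply/negP; apply: (acyclicP _ acF).
case/negP: Nvu; apply: connect_trans vx _.
by apply: connect_trans yu; apply: connect1.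
Qed.

Lemma acyclic_uniq_path F x s :
  acyclic F -> path (arc_rel F) x s -> uniq (x :: s).
Proof.
move=> /acyclicP acF; elim: s x => [//|y s IHs] x /= /andP[xy ys].
rewrite -[_ && uniq s]/(uniq (y :: s)) IHs // andbT.
by apply: contra (acF _ _ xy) => /(path_connect ys).
Qed.

(* For a maximal acyclic F, the sources of an F-closed set are stable in e:
   an arc of e outside F closes an F-cycle.  Peeling them off yields F-paths. *)
Lemma gallai_roy e W alpha r :
    irreflexive e ->
    (forall S, S \subset W -> {in S &, forall x y, ~~ e x y} -> #|S| <= alpha) ->
    r * alpha < #|W| ->
  exists x s, [/\ path e x s, uniq (x :: s), size s = r & {subset x :: s <= W}].
Proof.
move=> irr stab ltW.
have [F [FE acF maxF]] :=
  max_acyclic [set p | [&& p.1 \in W, p.2 \in W & e p.1 p.2]].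
have FP x y : (x, y) \in F -> [/\ x \in W, y \in W & e x y].
  by move/(subsetP FE); rewrite inE => /and3P[].
(* Closed sets [X] replace [W] so that sources can be deleted; paths along the acyclic [F] have
   distinct vertices for free. *)
suff main r' (X : {set V}) : X \subset W ->
    (forall x y, x \in X -> (x, y) \in F -> y \in X) ->
    r' * alpha < #|X| -> exists x s, [/\ path (arc_rel F) x s, size s = r' & x \in X].
  have upW x y : x \in W -> (x, y) \in F -> y \in W by move=> _ /FP[].
  have [x [s [xs sz xW]]] := main r W (subxx _) upW ltW.
  exists x, s; split=> //.
  - by apply: sub_path xs => a b /FP[].
  - exact: acyclic_uniq_path xs.
  - have: all (mem W) s.
      elim: s x {sz xW} xs => //= y s IHs x /andP[/FP[_ -> _]]; exact: IHs.
    by move=> /allP sW z; rewrite inE => /predU1P[-> // | /sW].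
elim: r' X => [|r' IHr] X XW upX ltX.
  have /card_gt0P[x xX] : 0 < #|X| by apply: leq_trans ltX.
  by exists x, [::].
pose S := [set y in X | [forall x in X, (x, y) \notin F]].
have SX : S \subset X by apply/subsetP => x; rewrite inE => /andP[].
have cardS : #|S| <= alpha.
  apply: stab; first exact: subset_trans XW.
  move=> x y; rewrite !inE => /andP[xX /forall_inP srcx] /andP[yX /forall_inP srcy].
  apply/negP => exy.
  have [xyF | /connectP[p]] : (x, y) \in F \/ connect (arc_rel F) y x.
  - by apply: maxF; rewrite inE /= !(subsetP XW).
  - by have := srcy x xX; rewrite xyF.
  (* The [F]-path from [y] to [x] stays in the closed set [X], so its last arc contradicts that [x]
     is a source. *)
  case/lastP: p => [_ /= xy | p z]; first by rewrite xy irr in exy.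
  rewrite rcons_path last_rcons => /andP[yp pz] xz.
  suff lX : last y p \in X by have := srcx _ lX; rewrite xz [_ \in F]pz.
  elim: p y yX yp {srcy exy pz} => //= w p IHp y yX /andP[/upX/(_) wX wp].
  by apply: IHp => //; apply: wX.
have [||| y [s [ys sz]]] := IHr (X :\: S).
- by apply: subset_trans XW; apply: subsetDl.
- move=> x y; rewrite !inE => /andP[_ xX] xyF; rewrite (upX x) // andbT.
  by apply/negP => /forall_inP/(_ x xX); rewrite xyF.
- by rewrite cardsD (setIidPr SX); move: ltX; rewrite mulSn; lia.
(* The start [y] is not a source of [X], so a predecessor in [X] can be prepended. *)
rewrite !inE => /andP[nS yX]; move: nS; rewrite yX /=.
case/forall_inPn => x xX; rewrite negbK => xyF.
by exists x, (y :: s); rewrite /= sz ys [arc_rel _ _ _]xyF.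
Qed.

End GallaiRoy.

(** * Embedding an oriented path run by run *)

Section Embedding.
Variable V : finType.
Implicit Types (e : rel V) (A B U S : {set V}).

Definition dir_rel e (b : bool) : rel V := fun x y => if b then e x y else e y x.

Fixpoint oriented_walk e (x : V) (o : seq bool) (s : seq V) : bool :=
  match o, s with
  | [::], [::] => true
  | b :: o', y :: s' => dir_rel e b x y && oriented_walk e y o' s'
  | _, _ => false
  end.

Lemma oriented_walk_run_cat e x b s o t :
    path (dir_rel e b) x s -> oriented_walk e (last x s) o t ->
  oriented_walk e x (nseq (size s) b ++ o) (s ++ t).
Proof.
by elim: s x => //= y s IHs x /andP[-> ys] /(IHs _ ys) ->.
Qed.

(** The default of [head] covers the empty word: [o'] is empty or starts with the letter opposite to
    [b]. *)
Lemma split_run (b : bool) (o : seq bool) :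
  exists r o', o = nseq r b ++ o' /\ head (~~ b) o' = ~~ b.
Proof.
elim: o => [|a o [r [o' [oE ho']]]]; first by exists 0, [::].
have [-> | nab] := eqVneq a b; first by exists r.+1, o'; rewrite oE.
by exists 0, (a :: o); split=> //=; case: a b nab {oE ho'} => [] [].
Qed.

Definition runs_le l (o : seq bool) :=
  forall p r b q, o = p ++ nseq r b ++ q -> r <= l.

Lemma runs_le_drop l p o : runs_le l (p ++ o) -> runs_le l o.
Proof. by move=> H p' r b q oE; apply: (H (p ++ p') r b q); rewrite oE catA. Qed.

(** A forward run leaves [x] in [A] and spends all its other vertices among the out-neighbours of
    [x] in [B]; its end then starts a backward run, symmetrically. [U] holds the vertices already
    used. *)
Lemma embed_from e S A B n l alpha d :
    irreflexive e -> A \subset S -> B \subset S ->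
    (forall X : {set V}, X \subset S ->
      {in X &, forall x y, ~~ e x y} -> #|X| <= alpha) ->
    0 < alpha -> n + l.-1 * alpha.-1 <= d ->
    {in A, forall x, d <= #|[set y in B | e x y]|} ->
    {in B, forall y, d <= #|[set x in A | e x y]|} ->
  forall o b x U, runs_le l o -> head b o = b -> x \in (if b then A else B) ->
    #|U| + size o <= n ->
  exists s : seq V, [/\ oriented_walk e x o s, uniq (x :: s), {in s, forall y, y \notin U}
              & {subset s <= S}].
Proof.
move=> irr AS BS stab a_gt0 le_d degA degB o.
have [m] := ubnP (size o); elim: m o => // m IHm [|b o] lto b' x U run_o /=.
  by move=> *; exists [::].
move=> <- {b'} xb leU.
have [r [o' [oE ho']]] := split_run b o; rewrite oE in lto run_o leU *.
have le_r : r.+1 <= l by apply: (run_o [::] r.+1 b o').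
move: lto leU; rewrite /= size_cat size_nseq => lto leU.
pose side (b' : bool) := if b' then A else B.
have sideS b' : side b' \subset S by case: b'.
pose W := [set y in side (~~ b) | dir_rel e b x y] :\: U.
have WE w : w \in W -> [/\ w \notin U, w \in side (~~ b) & dir_rel e b x w].
  by rewrite !inE => /and3P[].
(* The run has [r.+1] arcs, the first leading from [x] into [W]. Since
   [r * alpha = r * alpha.-1 + r] and [r <= l.-1], the term [n] in the bound on [d] pays for [U] and
   for the extra [r]. *)
have ltW : r * alpha < #|W|.
  have degx : d <= #|[set y in side (~~ b) | dir_rel e b x y]|.
    by move: xb; rewrite /side; case: (b) => xb; [apply: degA | apply: degB].
  have := cardsID U [set y in side (~~ b) | dir_rel e b x y].
  have := subset_leq_card (subsetIr [set y in side (~~ b) | dir_rel e b x y] U).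
  rewrite -/W; have : r * alpha.-1 <= l.-1 * alpha.-1 by rewrite leq_mul //; lia.
  have : r * alpha = r * alpha.-1 + r by rewrite -{1}(prednK a_gt0) mulnS addnC.
  lia.
have dir_irr : irreflexive (dir_rel e b) by move=> w; rewrite /dir_rel !irr if_same.
have WS : W \subset S.
  by apply/subsetP => w /WE[_ /(subsetP (sideS _))].
have [|y [s [ys uys sz sW]]] := gallai_roy (alpha := alpha) dir_irr _ ltW.
  move=> X XW Xst; apply: stab; first exact: subset_trans WS.
  by move=> u v uX vX; have := Xst _ _ uX vX; have := Xst _ _ vX uX; case: (b).
(* The end of the run stays out of [U'], being the start of the next walk. *)
pose U' := x |: U :|: [set w in belast y s].
have [|||t [zt uzt tU' tS]] :=
  IHm o' _ (~~ b) (last y s) U' (runs_le_drop (p := nseq r.+1 b) run_o) ho'.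
- lia.
- by have /WE[] := sW _ (mem_last y s).
- have : #|U'| <= #|U|.+1 + r.
    apply: leq_trans (leq_card_setU _ _) _; rewrite leq_add //.
      by rewrite cardsU1 -add1n leq_add2r leq_b1.
    by rewrite cardsE -sz -(size_belast y s); apply: card_size.
  lia.
have st_eq w : w \in t -> w \notin y :: s.
  move=> wt; rewrite lastI mem_rcons inE negb_or.
  have := tU' w wt; rewrite !inE !negb_or => /andP[_ ->]; rewrite andbT.
  by apply: contraTneq uzt => <-; rewrite /= wt.
exists (y :: s ++ t); split.
- rewrite /= -sz oriented_walk_run_cat // andbT.
  by have /WE[] := sW _ (mem_head y s).
- have uyst : uniq ((y :: s) ++ t).
    rewrite cat_uniq uys andTb; apply/andP; split; first by apply/hasPn => w /st_eq.
    by case/andP: uzt.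
  have : x \notin (y :: s) ++ t.
    rewrite mem_cat negb_or; apply/andP; split.
      by apply/negP => /sW/WE[_ _]; rewrite dir_irr.
    by apply/negP => /tU'; rewrite !inE eqxx.
  by move=> xyst; apply/andP.
- move=> w; rewrite -cat_cons mem_cat => /orP[/sW/WE[] // | /tU'].
  by rewrite !inE !negb_or => /andP[/andP[]].
- move=> w; rewrite -cat_cons mem_cat => /orP[/sW/(subsetP WS) // | /tS //].
Qed.

End Embedding.

(** * Arc counts and minimum degrees *)

Section Density.
Variable V : finType.
Implicit Types (e : rel V) (A B S : {set V}).

Definition arcs e A B := \sum_(x in A) \sum_(y in B) e x y.

Lemma card_rel_sum e x B : #|[set y in B | e x y]| = \sum_(y in B) e x y.
Proof. by rewrite cardsE -sum1_card big_mkcondr; apply: eq_bigr => y _; case: e. Qed.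

(* [A'] and [B'] may overlap: the embedding keeps track of used vertices. *)
Lemma min_degree_pair e A B d :
    d * (#|A| + #|B|) < arcs e A B ->
  exists A' B', [/\ A' \subset A, B' \subset B, A' != set0 /\ B' != set0,
    {in A', forall x, d <= #|[set y in B' | e x y]|} &
    {in B', forall y, d <= #|[set x in A' | e x y]|}].
Proof.
have [m] := ubnP (#|A| + #|B|); elim: m A B => // m IHm A B ltm ltE.
(* Deleting a vertex of degree below [d] lowers the threshold by [d] and the arc count by less, so
   the strict inequality survives and keeps both sets nonempty. *)
have [/existsP[x /andP[xA lowx]] | highA] :=
    boolP [exists x, (x \in A) && (#|[set y in B | e x y]| < d)].
  have EA : arcs e A B = \sum_(y in B) e x y + arcs e (A :\ x) B.
    rewrite /arcs (big_setD1 x) //.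
  have cA := cardsD1 x A; rewrite xA add1n in cA.
  have [||A' [B' [A'A B'B]]] := IHm (A :\ x) B; [lia | |].
    move: ltE lowx; rewrite card_rel_sum EA cA addSn mulnS; lia.
  by move=> *; exists A', B'; split=> //; apply: subset_trans A'A (subsetDl _ _).
have [/existsP[y /andP[yB lowy]] | highB] :=
    boolP [exists y, (y \in B) && (#|[set x in A | e x y]| < d)].
  have EB : arcs e A B = \sum_(x in A) e x y + arcs e A (B :\ y).
    rewrite /arcs -big_split /=; apply: eq_bigr => x _; rewrite (big_setD1 y) //.
  have cB := cardsD1 y B; rewrite yB add1n in cB.
  have [||A' [B' [A'A B'B]]] := IHm A (B :\ y); [lia | |].
    move: ltE lowy; rewrite (card_rel_sum (fun y x => e x y)) EB cB addnS mulnS; lia.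
  by move=> *; exists A', B'; split=> //; apply: subset_trans B'B (subsetDl _ _).
exists A, B; split=> //.
- split; apply: contraTneq ltE => ->; rewrite -leqNgt /arcs ?big_set0 //.
  by rewrite big1 // => x _; rewrite big_set0.
- move=> x xA; rewrite leqNgt; apply: contra highA => lowx.
  by apply/existsP; exists x; rewrite xA.
- move=> y yB; rewrite leqNgt; apply: contra highB => lowy.
  by apply/existsP; exists y; rewrite yB.
Qed.

(** The count added to its transpose meets every ordered pair of distinct vertices. *)
Lemma arcs_tournament (T : rel V) S :
  (forall x y, x != y -> T x y || T y x) -> #|S| * #|S|.-1 <= 2 * arcs T S S.
Proof.
move=> tot; rewrite mul2n -addnn {2}/arcs exchange_big /= -big_split /=.
rewrite -sum_nat_const; apply: leq_sum => x xS.
rewrite -big_split /= (big_setD1 x) //= (cardsD1 x) xS add1n /= -sum1_card.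
apply: leq_trans (leq_addl _ _); apply: leq_sum => y.
by rewrite !inE => /andP[/tot]; case: (T x y); case: (T y x).
Qed.

End Density.

(** * Induction on the number of colours *)

Section Upper.
Variables (V C : finType) (T : rel V) (c : V -> V -> C).
Variables (n l : nat) (o : seq bool).
Hypotheses (n_gt0 : 0 < n) (l_gt0 : 0 < l) (size_o : size o = n).
Hypotheses (run_o : runs_le l o) (irrT : irreflexive T).
Hypothesis totT : forall x y, x != y -> T x y || T y x.
Implicit Types (K : {set C}) (S : {set V}).

Definition mono_rel (col : C) : rel V := fun x y => T x y && (c x y == col).

Definition mono_walk S := exists col x s,
  [/\ oriented_walk (mono_rel col) x o s, uniq (x :: s) & {subset x :: s <= S}].

(** Averaging over colours: otherwise, with [q = #|K| * d], the arc count gives [#|S|.-1 <= 4 * q],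
    against [8 * q <= #|S|]. *)
Lemma dense_colour K S d :
    {in S &, forall x y, T x y -> c x y \in K} -> 0 < d -> 0 < #|K| ->
    8 * #|K| * d <= #|S| ->
  exists2 col, col \in K & d * (#|S| + #|S|) < arcs (mono_rel col) S S.
Proof.
move=> colS d_gt0 K_gt0 leS.
have [/exists_inP[col colK ltd] | low] :=
  boolP [exists col in K, d * (#|S| + #|S|) < arcs (mono_rel col) S S].
  by exists col.
have : arcs T S S <= #|K| * (d * (#|S| + #|S|)).
  have leT : arcs T S S <= \sum_(col in K) arcs (mono_rel col) S S.
    rewrite /arcs [leqRHS]exchange_big; apply: leq_sum => x xS.
    rewrite [leqRHS]exchange_big; apply: leq_sum => y yS.
    have [Txy | //] := boolP (T x y).
    by rewrite (bigD1 (c x y)) ?colS //= /mono_rel Txy eqxx.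
  apply: leq_trans leT _; rewrite -sum_nat_const; apply: leq_sum => col colK.
  rewrite leqNgt; apply: contra low => ltd; apply/exists_inP.
  by exists col.
have := arcs_tournament S totT; move: (arcs T S S) => E le1 le2.
have q_gt0 : 0 < #|K| * d by rewrite muln_gt0 K_gt0.
have {le2} : E <= 2 * (#|K| * d) * #|S| by lia.
move: leS q_gt0 le1; rewrite -mulnA; move: (#|K| * d) #|S| => q N leN q_gt0 leE ltE.
have N_gt0 : 0 < N by lia.
have : N.-1 <= 4 * q by rewrite -(leq_pmul2l N_gt0); lia.
lia.
Qed.

Lemma walk_or_stable K S d alpha :
    {in S &, forall x y, T x y -> c x y \in K} -> 0 < #|K| ->
    8 * #|K| * d <= #|S| -> 0 < alpha -> n + l.-1 * alpha.-1 <= d ->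
  mono_walk S \/ exists col S', [/\ col \in K, S' \subset S, alpha < #|S'| &
    {in S' &, forall x y, ~~ mono_rel col x y}].
Proof.
move=> colS K_gt0 leS a_gt0 le_d.
have d_gt0 : 0 < d by apply: leq_trans le_d; rewrite addn_gt0 n_gt0.
have [col colK dense] := dense_colour colS d_gt0 K_gt0 leS.
have [/existsP[S' /and3P[S'S ltS' /'forall_in_forall_inP st]] | Nst] :=
  boolP [exists S' : {set V}, [&& S' \subset S, alpha < #|S'| &
    [forall x in S', forall y in S', ~~ mono_rel col x y]]].
  by right; exists col, S'; split=> // x y xS'; apply: st.
left.
have irr : irreflexive (mono_rel col) by move=> x; rewrite /mono_rel irrT.
have [A [B [AS BS [/set0Pn[a aA] /set0Pn[b bB]] degA degB]]] := min_degree_pair dense.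
have stab (X : {set V}) : X \subset S ->
    {in X &, forall x y, ~~ mono_rel col x y} -> #|X| <= alpha.
  move=> XS st; rewrite leqNgt; apply: contra Nst => ltX.
  apply/existsP; exists X; rewrite XS ltX /=.
  by apply/forall_inP => x xX; apply/forall_inP => y yX; apply: st.
(* The first letter decides on which side the walk starts. *)
pose x := if head true o then a else b.
have xAB : x \in if head true o then A else B by rewrite /x; case: ifP.
have xS : x \in S by move: xAB; case: ifP => _; apply: subsetP.
have [||s [walk us _ sS]] := embed_from irr AS BS stab a_gt0 le_d degA degB
  (U := set0) run_o _ xAB.
- by case: (o).
- by rewrite cards0 size_o.
- exists col, x, s; split=> // z; rewrite inE => /predU1P[-> // | /sS //].
Qed.

Lemma upper_bound k K S :
    {in S &, forall x y, T x y -> c x y \in K} -> #|K| = k.+1 ->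
    c_const k.+1 * n * l ^ k <= #|S| ->
  mono_walk S.
Proof.
have cE k' : c_const k'.+1 = 8 * k'.+1 * c_const k'.
  by rewrite /c_const expnS factS; lia.
elim: k K S => [|k IHk] K S colS cardK.
  rewrite cE /c_const !expn0 !muln1 => leS.
  (* With one colour, two vertices of a stable set would be joined by an arc of that colour. *)
  have := walk_or_stable (d := n) (alpha := 1) colS.
  rewrite cardK muln0 addn0 => /(_ isT leS isT (leqnn n))[// | ].
  case=> col [S' [colK S'S /card_gt1P[x [y [xS' yS' xy]]] st]].
  have /eqP/cards1P[col' KE] := cardK.
  have colE u v : u \in S' -> v \in S' -> T u v -> False.
    move=> uS' vS' uv; have := st u v uS' vS'; rewrite /mono_rel uv /=.
    have := colS u v (subsetP S'S _ uS') (subsetP S'S _ vS') uv.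
    by move: colK; rewrite KE !inE => /eqP-> ->.
  by case/orP: (totT xy) => /colE; case.
(* [m] is the size that the induction hypothesis requires; [alpha = m.-1] and [d = m * l] are used
   below, so a stable set that is too large has at least [m] vertices. *)
set m := c_const k.+1 * n * l ^ k => leS.
have m_ge : 8 * n <= m.
  have ck : 0 < k.+1 * c_const k by rewrite muln_gt0 /c_const muln_gt0 expn_gt0 fact_gt0.
  have lk : 0 < l ^ k by rewrite expn_gt0 l_gt0.
  have -> : m = 8 * n * (k.+1 * c_const k * l ^ k) by rewrite /m cE; lia.
  by rewrite leq_pmulr // muln_gt0 ck.
have le_d : n + l.-1 * m.-1.-1 <= m * l by case: (l) l_gt0 => // l' _; nia.
have leS' : 8 * #|K| * (m * l) <= #|S|.
  by apply: leq_trans leS; rewrite cardK cE expnSr /m; lia.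
have [||//|[col [S' [colK S'S ltS' st]]]] := walk_or_stable colS _ leS' _ le_d.
- by rewrite cardK.
- by lia.
have [||| col' [x [s [walk us sS]]]] := IHk (K :\ col) S'.
- move=> x y xS' yS' xy; rewrite in_setD1 colS ?(subsetP S'S) // andbT.
  by apply: contra (st x y xS' yS') => /eqP colE; rewrite /mono_rel xy colE eqxx.
- by have := cardsD1 col K; rewrite colK cardK add1n => -[].
- by rewrite -/m; lia.
- by exists col', x, s; split=> // z /sS /(subsetP S'S).
Qed.

End Upper.

(** * Orientation words and their longest runs *)

Lemma oriented_walk_nth (V : finType) (e : rel V) x0 x o s :
    oriented_walk e x o s ->
  size s = size o /\
  forall i, i < size o -> dir_rel e (nth true o i) (nth x0 (x :: s) i) (nth x0 s i).
Proof.
elim: o x s => [|b o IHo] x [|y s] //= /andP[xy /IHo[-> IH]].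
by split=> // -[|i] //=; apply: IH.
Qed.

Section LongestRun.
Variables (n : nat) (o : 'I_n -> bool).

Definition word := [seq o i | i <- enum 'I_n].

Lemma size_word : size word = n.
Proof. by rewrite size_map size_enum_ord. Qed.

Lemma nth_word (i : 'I_n) : nth true word i = o i.
Proof. by rewrite (nth_map i) ?size_enum_ord // nth_ord_enum. Qed.

Lemma runs_le_lP : runs_le (lP o) word.
Proof.
move=> p r b q wE.
have szw : size p + r + size q = n.
  by rewrite -size_word wE !size_cat size_nseq addnA.
have lti : size p < n.+1 by lia.
have ltj : size p + r < n.+1 by lia.
apply: leq_trans (leq_bigmax (Ordinal lti)) => /=.
apply: leq_trans (leq_bigmax_cond (Ordinal ltj) _); first by rewrite /= addKn.
have bE (i : 'I_n) : size p <= i < size p + r -> o i = b.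
  move=> /andP[le_i lt_i]; rewrite -nth_word wE nth_cat ltnNge le_i /=.
  by rewrite nth_cat size_nseq nth_nseq ltn_subLR // lt_i.
rewrite /= leq_addr; apply/forallP => e1; apply/forallP => e2.
by apply/implyP => /andP[/bE-> /bE->].
Qed.

Lemma lP_gt0 : 0 < n -> 0 < lP o.
Proof.
move=> n_gt0; have := runs_le_lP (p := [::]) (r := 1).
have := size_word; case: word => [|b w _ /(_ b w)]; last exact.
by move=> /= n0; rewrite -n0 in n_gt0.
Qed.

(** Were the maximum not reached, every term would be at most [(lP o).-1]. As [lP o] is positive,
    the run has a first edge, which supplies [b]. *)
Lemma lP_attained : 0 < n ->
  exists i j b, [/\ i <= j <= n, lP o <= j - i &
    forall e : 'I_n, i <= e < j -> o e = b].
Proof.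
move=> n_gt0; have l_gt0 := lP_gt0 n_gt0.
have [/existsP[i /existsP[j /and3P[le_ij /forallP run le_l]]] | Nrun] :=
  boolP [exists i : 'I_n.+1, exists j : 'I_n.+1,
    [&& i <= j, directed_run o i j & lP o <= j - i]].
  have lti : i < n by have := ltn_ord j; lia.
  exists i, j, (o (Ordinal lti)); split=> //; first by rewrite le_ij -ltnS ltn_ord.
  move=> e ije; have /forallP/(_ (Ordinal lti)) := run e.
  by rewrite ije /= leqnn /=; case: ltnP => [_ /eqP // | ]; lia.
suff : lP o <= (lP o).-1 by lia.
apply/bigmax_leqP => i _; apply/bigmax_leqP => j /andP[le_ij run].
rewrite -ltnS prednK // ltnNge; apply: contra Nrun => le_l.
by apply/existsP; exists i; apply/existsP; exists j; rewrite le_ij run.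
Qed.

End LongestRun.

(** * The two bounds for the Ramsey property *)

Lemma ramsey_upper k n (o : 'I_n -> bool) :
  0 < n -> ramsey_prop o k.+1 (c_const k.+1 * n * lP o ^ k).
Proof.
move=> n_gt0 T c [irrT totT].
have irr : irreflexive T by move=> x; apply/negbTE.
have tot x y : x != y -> T x y || T y x by move=> /totT /andP[].
have [|||col [x [s [walk us _]]]] := upper_bound (c := c) (K := setT) (S := setT)
  n_gt0 (lP_gt0 o n_gt0) (size_word o) (@runs_le_lP n o) irr tot (k := k).
- by move=> x y; rewrite inE.
- by rewrite cardsT card_ord.
- by rewrite cardsT card_ord.
have [sz adj] := oriented_walk_nth x walk; rewrite size_word in sz adj.
exists col, (fun i => nth x (x :: s) i); split.
  move=> i j /eqP; rewrite nth_uniq ?[size _]/= ?sz ?ltn_ord //.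
  by move/eqP/val_inj.
move=> e /=; have := adj e (ltn_ord e); rewrite nth_word /dir_rel /mono_rel /=.
by rewrite /bump /=; case: (o e) => /andP[? /eqP].
Qed.

Lemma ramsey_lower k n (o : 'I_n -> bool) N :
  0 < n -> N <= n * lP o ^ k -> ~ ramsey_prop o k.+1 N.
Proof.
move=> n_gt0 leN; have l_gt0 := lP_gt0 o n_gt0; set l := lP o in leN l_gt0.
pose Z j x := x %/ n %/ l ^ j.
pose col x y := find (fun j => Z j x == Z j y) (iota 0 k.+1).
move=> /(_ (fun x y => x < y) (fun x y => inord (col x y)))[].
  split=> [i | i j]; first by rewrite ltnn.
  by rewrite -val_eqE /=; lia.
move=> c [f [f_inj fP]].
(* Indexing by naturals makes [t.+1] available; [g] follows [f] for [t <= n]. *)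
pose g t : nat := f (inord t).
have ltg t : g t < n * l ^ k by apply: leq_trans leN; apply: ltn_ord.
(* At level [k] all quotients vanish, so the search in [col] succeeds. *)
have Zk t : Z k (g t) = 0.
  apply: divn_small; rewrite ltn_divLR //; first by rewrite mulnC.
have colP t u : let j := col (g t) (g u) in
    [/\ j < k.+1, Z j (g t) = Z j (g u) & forall i, i < j -> Z i (g t) <> Z i (g u)].
  have hasj : has (fun j => Z j (g t) == Z j (g u)) (iota 0 k.+1).
    by apply/hasP; exists k; rewrite ?mem_iota ?Zk ?leqnn.
  have := hasj; rewrite has_find size_iota => ltj; split=> //.
    by apply/eqP; have := nth_find 0 hasj; rewrite nth_iota.
  move=> i lti /eqP; have := before_find 0 lti.
  by rewrite nth_iota ?(leq_trans lti) 1?ltnW // add0n => ->.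
have col_sym t u : col (g t) (g u) = col (g u) (g t).
  by rewrite /col; apply: eq_find => j; rewrite eq_sym.
have edgeP (e : 'I_n) : (if o e then g e < g e.+1 else g e.+1 < g e) /\
    col (g e) (g e.+1) = c.
  have := fP e; rewrite /=.
  have -> : f (pvert e) = f (inord e).
    by congr f; apply: val_inj; rewrite /= inordK // ltnW // ltnS ltn_ord.
  have -> : f (pvert' e) = f (inord e.+1).
    by congr f; apply: val_inj; rewrite /= inordK // ltnS ltn_ord.
  have [ltc _ _] := colP e e.+1; have [ltc' _ _] := colP e.+1 e.
  rewrite -/(g _) -/(g _); case: (o e) => -[lt_g <-]; split=> //.
    by rewrite inordK.
  by rewrite inordK // col_sym.
have Zc t : t <= n -> Z c (g t) = Z c (g 0).
  elim: t => // t IHt ltt; rewrite -IHt 1?ltnW //.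
  by have [_ <-] := edgeP (Ordinal ltt); have [_ -> _] := colP t t.+1.
have Zneq t i : t < n -> i < c -> Z i (g t) <> Z i (g t.+1).
  move=> ltt; have [_ <-] := edgeP (Ordinal ltt).
  by have [_ _ H] := colP t t.+1; apply: H.
case cE: (nat_of_ord c) Zc Zneq => [|j] Zc Zneq.
  (* All [n.+1] vertices lie in one block of size [n]. *)
  have lt_mod (i : 'I_n.+1) : f i %% n < n by rewrite ltn_mod.
  suff inj : injective (fun i => Ordinal (lt_mod i)).
    by have := leq_card _ inj; rewrite !card_ord ltnn.
  have gE (i : 'I_n.+1) : f i %/ n = g 0 %/ n.
    by have := Zc i; rewrite /Z expn0 !divn1 /g inord_val -ltnS => ->.
  move=> i i' [eq_mod]; apply: f_inj; apply: val_inj.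
  by rewrite /= (divn_eq (f i) n) (divn_eq (f i') n) !gE eq_mod.
have mono x y : x <= y -> Z j x <= Z j y by move=> le_xy; rewrite !leq_div2r.
have Zl t : t <= n -> Z j (g t) %/ l = Z j (g 0) %/ l.
  by move=> let_; have := Zc t let_; rewrite /Z expnSr !divnMA.
have [i [i' [b [/andP[le_i le_i'] le_l run]]]] := lP_attained o n_gt0.
have div_lt x y : x + l <= y -> x %/ l < y %/ l.
  move=> le_xy; apply: leq_trans (leq_div2r l le_xy).
  by rewrite divnDr // divnn l_gt0 addn1.
(* The arc gives a weak inequality between the quotients, and colour [j.+1] makes them differ. *)
have step t : i <= t < i' ->
    if b then Z j (g t) < Z j (g t.+1) else Z j (g t.+1) < Z j (g t).
  move=> itt; have ltt : t < n by lia.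
  have := Zneq t j ltt (leqnn _).
  have [] := edgeP (Ordinal ltt); rewrite /= (run (Ordinal ltt)) //.
  by case: (b) => /ltnW/mono; lia.
(* After [l] arcs of a longest run [Z j] has moved by at least [l], so its quotient by [l] changes,
   against [Zl]. *)
have climb d : i + d <= i' ->
    if b then Z j (g i) + d <= Z j (g (i + d)) else Z j (g (i + d)) + d <= Z j (g i).
  elim: d => [|d IHd]; first by rewrite !addn0 leqnn if_same.
  rewrite addnS => ltd; have := IHd (ltnW ltd); have := step (i + d).
  by rewrite leq_addr ltd => /(_ isT); case: (b); lia.
have := climb l; have le_il : i + l <= i' by rewrite -/l in le_l; lia.
move=> /(_ le_il).
have eqZ : Z j (g (i + l)) %/ l = Z j (g i) %/ l by rewrite !Zl //; lia.
by case: (b) => /div_lt; rewrite eqZ ltnn.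
Qed.

(** [P] is an arbitrary proposition, so excluded middle decides whether a smaller witness exists. *)
Lemma least_nat (P : nat -> Prop) m :
  P m -> exists2 n, P n & forall i, P i -> n <= i.
Proof.
elim/ltn_ind: m => m IHm Pm.
have [[i [ltim Pi]] | Nlt] := classic (exists i, i < m /\ P i); first exact: IHm ltim Pi.
exists m => // i Pi; rewrite leqNgt; apply/negP => ltim; apply: Nlt.
by exists i.
Qed.

Theorem theorem2 (k n : nat) (o : 'I_n -> bool) :
  1 <= k -> 1 <= n ->
  exists N0, is_RT o k N0 /\
    n * (lP o) ^ k.-1 <= N0 <= c_const k * n * (lP o) ^ k.-1.
Proof.
case: k => // k _ n_gt0.
have [N0 ramN0 minN0] := least_nat (@ramsey_upper k n o n_gt0).
exists N0; split=> //; rewrite (minN0 _ (@ramsey_upper k n o n_gt0)) andbT.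
by rewrite leqNgt; apply/negP => /ltnW/(ramsey_lower n_gt0)/(_ ramN0).
Qed.
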